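(* Let $d\ge1$ and let $a_1,\dots,a_d,b_1,\dots,b_d$ be pairwise distinct complex numbers. Let $0\le m\le d$ and $J\in C_d^m$. Then $$\sum_{I\in C_d^m}\mathcal{R}\big(h_{IJ},\,1/h_{I'J'}\big)=\sum_{I\in C_d^m}\mathcal{R}\big(h_{JI},\,1/h_{J'I'}\big)=1.$$
   Context: $C_d^m$ denotes the set of all increasing sequences $(i_1<\dots<i_m)$ of length $m$ in $\{1,\dots,d\}$, identified with $m$-element subsets; for $I\in C_d^m$, $I'=\{1,\dots,d\}\setminus I$. For $I,J$ of equal cardinality put $$h_{IJ}(z)=\frac{\prod_{i\in I}(z-a_i)}{\prod_{j\in J}(z-b_j)},$$ (empty products equal $1$). So $h_{IJ}h_{I'J'}=h$, where $h(z)=\prod_{i=1}^d\frac{z-a_i}{z-b_i}$. For rational functions $f,g$ on the Riemann sphere $\mathbb{P}$ with divisors of disjoint supports, the meromorphic resultant is $\mathcal{R}(f,g)=\prod_{a\in\mathbb{P}}g(a)^{\operatorname{ord}_a(f)}$. *)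

(* Defs.v *)
(* MathComp, with MathComp-Analysis for realType and products over sets of
   finite support, and real-closed for the complex numbers R[i]. *)
From HB Require Import structures.
From mathcomp Require Export all_boot all_order all_algebra.
From mathcomp Require Export fraction.
From mathcomp Require Export all_classical all_reals.
From mathcomp Require Export complex.

Set Implicit Arguments.
Unset Strict Implicit.
Unset Printing Implicit Defensive.

Import GRing.Theory.
Local Open Scope ring_scope.
Local Open Scope quotient_scope.
Local Open Scope classical_set_scope.

Local Notation "x %:F" := (tofrac x).

Section RationalFunctions.
Variable F : fieldType.

(* [None] is the point at infinity; for F = R[i] this is the Riemann sphere. *)
Definition sphere := option F.

Definition ratfun := {fraction {poly F}}.

Implicit Types (f g : ratfun) (x : sphere).

(* A representing pair; it need not be in lowest terms. *)
Definition rf_num f : {poly F} := \n_(repr f).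
Definition rf_den f : {poly F} := \d_(repr f).

(* Meaningful for f != 0.  At infinity the order is deg (den) - deg (num), and
   size is deg + 1 on nonzero polynomials. *)
Definition rf_ord f x : int :=
  match x with
  | Some c => (mup c (rf_num f))%:Z - (mup c (rf_den f))%:Z
  | None => (size (rf_den f))%:Z - (size (rf_num f))%:Z
  end.

(* f as a map of the sphere to itself: after cancelling the common factors, the
   finite poles are the roots of q.  When deg p <= deg q, the coefficient of p
   of index deg q is 0 if the inequality is strict, and lead_coef p otherwise. *)
Definition rf_eval f x : sphere :=
  let p := rf_num f %/ gcdp (rf_num f) (rf_den f) in
  let q := rf_den f %/ gcdp (rf_num f) (rf_den f) in
  match x with
  | Some c => if q.[c] == 0 then None else Some (p.[c] / q.[c])
  | None => if (size q < size p)%N then None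
            else Some (p`_(size q).-1 / lead_coef q)
  end.

(* Meaningful for nonzero f and g whose divisors have disjoint supports: then
   the factors differ from 1 at finitely many points only, and g x is a nonzero
   element of F wherever the exponent is not 0, so that the default value for
   g x = infinity is only ever raised to the power 0. *)
Definition resultant_mero f g : F :=
  \big[*%R/1]_(x \in [set: sphere]) odflt 0 (rf_eval g x) ^ rf_ord f x.

(* The indices 1, ..., d are shifted to 0, ..., d - 1. *)
Definition h_ratfun (d : nat) (a b : 'I_d -> F) (I J : {set 'I_d}) : ratfun :=
  (\prod_(i in I) ('X - (a i)%:P)%:F) / (\prod_(j in J) ('X - (b j)%:P)%:F).

End RationalFunctions.

(* Main.v *)
Require Import Defs.
From mathcomp Require Import ring.

Set Implicit Arguments.
Unset Strict Implicit.
Unset Printing Implicit Defensive.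

Import GRing.Theory.
Local Open Scope ring_scope.

(** Since [#|I| = #|J|], the divisor of h_IJ consists of the zeros a_i, i in I,
    and the poles b_j, j in J, all simple, with nothing at infinity.  Hence
      R(h_IJ, 1 / h_I'J') = prod_(i in I) g(a_i) / prod_(j in J) g(b_j)
    with g(z) = prod_(l in J') (z - b_l) / prod_(k in I') (z - a_k), which is
    [resultant_mero_h].  Clearing the factor prod (b_j - b_l), j in J, l in J',
    which does not depend on I, turns the first sum into the identity
      sum_I prod (a_i - c) * prod (b - a_k) / prod (a_i - a_k)
        = prod (b - c),
    where i runs over I, k over I', b over the b_j with j in J, and c over the
    b_l with l in J'.

    This is [sum_split_term], proved by induction on the number of the c's for
    an arbitrary finite set of nodes a_k, as many as there are b's and c's
    together.  As functions of one chosen c, both sides are polynomials of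
    degree at most the number of b's, and there are more nodes than that, so it
    is enough to compare them at c = a_k.  There only the I avoiding k
    contribute, the factors a_i - a_k cancel between numerator and denominator,
    and what is left is prod_b (b - a_k) times the identity with the node a_k
    and the variable c removed.

    The explicit product for the resultant is symmetric under exchanging (a, I)
    with (b, J), so the second sum is the first one with a and b exchanged. *)

(** * The split sum identity *)

Section SplitSum.
Variables (F : fieldType) (T : finType) (x : T -> F).
Hypothesis x_inj : injective x.

Lemma size_prod_CsubX (I : Type) (r : seq I) (P : pred I) (c : I -> F) :
  (size (\prod_(i <- r | P i) ((c i)%:P - 'X))%R <= (count P r).+1)%N.
Proof.
elim: r => [|i r IHr]; first by rewrite big_nil size_poly1.
rewrite big_cons /=; case: (P i) => //=.
apply: leq_trans (size_polyMleq _ _) _.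
by rewrite -opprB size_polyN size_XsubC addnC addn2 /= add1n ltnS.
Qed.

Definition split_term (bs cs : seq F) (A I : {set T}) : F :=
  (\prod_(i in I) \prod_(c <- cs) (x i - c)) *
  (\prod_(k in A :\: I) \prod_(b <- bs) (b - x k)) /
  \prod_(i in I) \prod_(k in A :\: I) (x i - x k).

Lemma split_term_cons (bs cs : seq F) (c : F) (A I : {set T}) :
  split_term bs (c :: cs) A I =
  (\prod_(i in I) (x i - c)) * split_term bs cs A I.
Proof.
rewrite /split_term; under eq_bigr do rewrite big_cons.
by rewrite big_split /= !mulrA.
Qed.

(** At the node [x k], the new factors x i - x k cancel those which [k]
    contributes to the denominator, so that [k] leaves the node set. *)
Lemma split_term_cons_at (bs cs : seq F) (A I : {set T}) (k : T) :
  k \in A -> I \subset A :\ k ->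
  split_term bs (x k :: cs) A I =
  (\prod_(b <- bs) (b - x k)) * split_term bs cs (A :\ k) I.
Proof.
move=> kA /fintype.subsetP sIA.
have kI : k \notin I by apply/negP => /sIA; rewrite !inE eqxx.
rewrite split_term_cons /split_term.
have kAI : k \in A :\: I by rewrite inE kI.
have -> : A :\ k :\: I = (A :\: I) :\ k by rewrite !finset.setDDl finset.setUC.
rewrite (big_setD1 k kAI) /=.
under [X in _ / X]eq_bigr do rewrite (big_setD1 k kAI) /=.
rewrite big_split /=.
have nz : \prod_(i in I) (x i - x k) != 0.
  apply/prodf_neq0 => i iI; rewrite subr_eq0 (inj_eq x_inj).
  by apply: contraNneq kI => <-.
rewrite invfM; set P := \prod_(i in I) (x i - x k) in nz *.
by rewrite -[RHS]mul1r -(mulfV nz); ring.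
Qed.

(** By interpolation at the nodes in [A], in the head [c] of [cs]: both sides
    have degree at most [size bs] in [c], less than the number of nodes, and at
    each node they agree by induction. *)
Lemma sum_split_term (bs cs : seq F) (A : {set T}) :
  #|A| = (size bs + size cs)%N ->
  \sum_(I : {set T} | (I \subset A) && (#|I| == size bs)) split_term bs cs A I
  = \prod_(b <- bs) \prod_(c <- cs) (b - c).
Proof.
elim: cs A => [|c cs IHcs] A cardA.
  (* Without c's, the only subset of the right size is A itself. *)
  rewrite addn0 in cardA.
  rewrite (big_pred1 A) => [|I /=]; last first.
    rewrite -cardA eqEcard; apply: andb_id2l => sIA.
    by rewrite eqn_leq subset_leq_card.
  rewrite /split_term finset.setDv big_set0 mulr1.
  under eq_bigr do rewrite big_nil.
  under [X in _ / X]eq_bigr do rewrite big_set0.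
  rewrite !big1 ?divr1 //.
  by move=> b _; rewrite big_nil.
pose Q : {poly F} :=
  \sum_(I : {set T} | (I \subset A) && (#|I| == size bs))
     split_term bs cs A I *: \prod_(i in I) ((x i)%:P - 'X)
  - (\prod_(b <- bs) \prod_(c <- cs) (b - c)) *: \prod_(b <- bs) (b%:P - 'X).
have QE z : Q.[z] = \sum_(I : {set T} | (I \subset A) && (#|I| == size bs))
     split_term bs (z :: cs) A I - \prod_(b <- bs) \prod_(c <- z :: cs) (b - c).
  rewrite hornerD hornerN hornerZ horner_sum horner_prod; congr (_ - _).
    apply: eq_bigr => I _; rewrite split_term_cons hornerZ horner_prod mulrC.
    by congr (_ * _); apply: eq_bigr => i _; rewrite !hornerE.
  rewrite mulrC -big_split; apply: eq_bigr => b _ /=.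
  by rewrite big_cons !hornerE.
suff Q0 : Q = 0 by apply/eqP; rewrite -subr_eq0 -QE Q0 horner0.
apply: (@roots_geq_poly_eq0 _ _ [seq x k | k <- enum A]).
- apply/allP => _ /mapP[k kA ->]; rewrite mem_enum in kA.
  rewrite /root QE subr_eq0; apply/eqP.
  rewrite (bigID (fun I : {set T} => k \in I)) /= big1 ?add0r; last first.
    move=> I /andP[_ kI]; rewrite split_term_cons (bigD1 k) //=.
    by rewrite subrr !mul0r.
  have cardAk : #|A :\ k| = (size bs + size cs)%N.
    by move: cardA; rewrite (cardsD1 k) kA addnS add1n => -[].
  transitivity ((\prod_(b <- bs) (b - x k)) *
                \prod_(b <- bs) \prod_(c <- cs) (b - c)).
    rewrite -(IHcs _ cardAk) mulr_sumr; apply: eq_big => I.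
      by rewrite finset.subsetD1 andbAC.
    move=> /andP[/andP[sIA _] kI].
    by rewrite split_term_cons_at // finset.subsetD1 sIA.
  by rewrite -big_split; apply: eq_bigr => b _; rewrite big_cons.
- by rewrite map_inj_uniq ?enum_uniq.
rewrite size_map -cardE cardA /= addnS.
apply: leq_trans (_ : (size bs).+1 <= _)%N; last by rewrite ltnS leq_addr.
apply: leq_trans (size_polyD _ _) _; rewrite size_polyN geq_max.
apply/andP; split; last first.
  apply: leq_trans (size_scale_leq _ _) _.
  by apply: leq_trans (size_prod_CsubX _ _ _) _; rewrite count_predT.
apply: (big_ind (fun p : {poly F} => (size p <= (size bs).+1)%N)) 
  => [|p q pS qS|I /andP[_ /eqP <-]].
- by rewrite size_poly0.
- by apply: leq_trans (size_polyD _ _) _; rewrite geq_max pS.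
apply: leq_trans (size_scale_leq _ _) _.
by rewrite cardE -[X in (_ <= X.+1)%N]count_predT -big_enum size_prod_CsubX.
Qed.
End SplitSum.

(** * Resultants of products of linear factors *)

Section Resultant.
Variable F : fieldType.
Implicit Types (f g : ratfun F) (p q u v : {poly F}) (s t : seq F).

Local Notation "x %:F" := (tofrac x).

Lemma rf_den_neq0 f : rf_den f != 0.
Proof. exact: denom_ratioP. Qed.

Lemma rf_numdenE f : f = (rf_num f)%:F / (rf_den f)%:F.
Proof.
have d0 : (rf_den f)%:F != 0 by rewrite tofrac_eq0 rf_den_neq0.
apply: (mulIf d0); rewrite mulfVK // /rf_den /rf_num -{1}[f]reprK.
move: (repr f) => y; rewrite !piE; apply/eqmodP.
rewrite /= FracField.equivfE /FracField.mulf.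
rewrite !numden_Ratio ?mulf_neq0 ?oner_neq0 ?denom_ratioP //.
by rewrite !mulr1 mulrC.
Qed.

(** The chosen representative of a fraction is unknown; cross-multiplication
    is all that relates it to a given pair, and suffices for orders and
    values. *)
Lemma rf_cross p q : q != 0 ->
  rf_num (p%:F / q%:F) * q = p * rf_den (p%:F / q%:F).
Proof.
move=> q0; have := rf_numdenE (p%:F / q%:F).
have := rf_den_neq0 (p%:F / q%:F).
move: (rf_num _) (rf_den _) => n d d0 /eqP.
rewrite eqr_div ?tofrac_eq0 // -!rmorphM tofrac_eq => /eqP e.
by rewrite -e.
Qed.

Lemma rf_num_neq0 p q : p != 0 -> q != 0 -> rf_num (p%:F / q%:F) != 0.
Proof.
move=> p0 q0; have := rf_cross p q0; apply: contra_eq_neq => ->.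
by rewrite mul0r eq_sym mulf_neq0 ?rf_den_neq0.
Qed.

Lemma rf_ord_div p q c : p != 0 -> q != 0 ->
  rf_ord (p%:F / q%:F) (Some c) = (mup c p)%:Z - (mup c q)%:Z.
Proof.
move=> p0 q0; have n0 := rf_num_neq0 p0 q0.
have := congr1 (mup c) (rf_cross p q0).
rewrite !mupM ?rf_den_neq0 // => /(congr1 Posz); rewrite !PoszD /= => e.
by apply/eqP; rewrite subr_eq addrAC eq_sym subr_eq e.
Qed.

Lemma rf_ord_div_inf p q : p != 0 -> q != 0 ->
  rf_ord (p%:F / q%:F) None = (size q)%:Z - (size p)%:Z.
Proof.
move=> p0 q0; have n0 := rf_num_neq0 p0 q0.
have := congr1 (fun r : {poly F} => size r) (rf_cross p q0).
rewrite /= !size_mul ?rf_den_neq0 // => e.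
have {e} : (size (rf_num (p%:F / q%:F)) + size q = 
  size p + size (rf_den (p%:F / q%:F)))%N.
  have [pP qP] : (0 < size p /\ 0 < size q)%N by rewrite !lt0n !size_poly_eq0.
  by move: e; rewrite -(prednK pP) -(prednK qP) !addnS !addSn /= => ->.
move=> /(congr1 Posz); rewrite !PoszD /= => e.
by apply/eqP; rewrite subr_eq addrAC eq_sym subr_eq addrC e addrC.
Qed.

(** Cancelling the common factor of the representative leaves a coprime pair,
    whose denominator cannot vanish where [q] does not: its numerator would
    vanish there too. *)
Lemma rf_eval_div p q c : q.[c] != 0 ->
  rf_eval (p%:F / q%:F) (Some c) = Some (p.[c] / q.[c]).
Proof.
move=> qc; have q0 : q != 0 by apply: contraNneq qc => ->; rewrite horner0.
have := rf_cross p q0; rewrite /rf_eval; set f := _ / _.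
set n := rf_num f; set d := rf_den f; set g := gcdp n d => e.
have d0 : d != 0 by exact: rf_den_neq0.
have g0 : g != 0 by rewrite gcdp_eq0 negb_and d0 orbT.
have cop : coprimep (n %/ g) (d %/ g).
  by apply: coprimep_div_gcd; rewrite d0 orbT.
have {}e : (n %/ g) * q = p * (d %/ g).
  apply: (mulIf g0); rewrite mulrAC divpK ?dvdp_gcdl //.
  by rewrite e -mulrA divpK ?dvdp_gcdr.
have ec : (n %/ g).[c] * q.[c] = p.[c] * (d %/ g).[c] by rewrite -!hornerM e.
case: ifPn => [/eqP dc|dc].
  have : (n %/ g).[c] = 0.
    by apply/eqP; move/eqP: ec; rewrite dc mulr0 mulf_eq0 (negbTE qc) orbF.
  move/eqP/(coprimep_root cop); by rewrite dc eqxx.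
by congr Some; apply/eqP; rewrite eqr_div // ec.
Qed.

Local Arguments rf_ord : simpl never.
Local Arguments rf_eval : simpl never.

(** Equal numbers of zeros and poles make the order at infinity vanish, so the
    value of the second function there is irrelevant; only the zeros and poles
    in the plane contribute, each with order 1 or -1 by uniqueness. *)
Lemma resultant_mero_prod s t u v :
  uniq (s ++ t) -> size s = size t ->
  (forall c, c \in s ++ t -> v.[c] != 0) ->
  resultant_mero
    ((\prod_(c <- s) ('X - c%:P))%:F / (\prod_(c <- t) ('X - c%:P))%:F)
    (u%:F / v%:F) =
  (\prod_(c <- s) (u.[c] / v.[c])) / \prod_(c <- t) (u.[c] / v.[c]).
Proof.
move=> st_uniq sz v0; rewrite /resultant_mero.
have Pn0 (r : seq F) : \prod_(c <- r) ('X - c%:P) != 0 :> {poly F}.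
  exact/monic_neq0/monic_prod_XsubC.
have ordE c : rf_ord
    ((\prod_(c <- s) ('X - c%:P))%:F / (\prod_(c <- t) ('X - c%:P))%:F) (Some c)
   = (count_mem c s)%:Z - (count_mem c t)%:Z.
  by rewrite rf_ord_div // !mu_prod_XsubC.
rewrite -(fsbig_widen [set` [seq Some c | c <- s ++ t]]) //; last first.
  move=> [c|] [_ /= /negP cst]; last first.
    by rewrite rf_ord_div_inf // !size_prod_XsubC sz subrr expr0z.
  move: cst; rewrite (mem_map (@Some_inj _)) mem_cat negb_or => /andP[cs ct].
  by rewrite ordE (count_memPn cs) (count_memPn ct) expr0z.
rewrite -fsbig_seq /=; last by rewrite map_inj_uniq // => ? ? [].
move: (st_uniq); rewrite cat_uniq => /and3P[us /hasPn dis ut].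
rewrite big_map big_cat /= -prodfV; congr (_ * _); apply: eq_big_seq => c cst.
  rewrite ordE count_uniq_mem // cst (count_memPn _).
    by rewrite rf_eval_div // v0 // mem_cat cst.
  by apply/negP => ct; move: (dis _ ct); rewrite cst.
rewrite ordE (count_uniq_mem _ ut) cst (count_memPn _) ?dis //.
by rewrite rf_eval_div // v0 // mem_cat cst orbT.
Qed.

Lemma h_ratfunE d (a b : 'I_d -> F) (I J : {set 'I_d}) :
  h_ratfun a b I J =
  (\prod_(c <- [seq a i | i <- enum I]) ('X - c%:P))%:F /
  (\prod_(c <- [seq b j | j <- enum J]) ('X - c%:P))%:F.
Proof. by rewrite /h_ratfun !big_map !big_enum !rmorph_prod. Qed.

Lemma resultant_mero_h d (a b : 'I_d -> F) (I J : {set 'I_d}) :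
  injective a -> injective b -> (forall i j, a i <> b j) -> #|I| = #|J| ->
  resultant_mero (h_ratfun a b I J) (h_ratfun a b (~: I) (~: J))^-1 =
  (\prod_(i in I) \prod_(l in ~: J) (a i - b l)) *
  (\prod_(j in J) \prod_(k in ~: I) (b j - a k)) /
  ((\prod_(i in I) \prod_(k in ~: I) (a i - a k)) *
   (\prod_(j in J) \prod_(l in ~: J) (b j - b l))).
Proof.
move=> a_inj b_inj ab cardIJ.
have hc (f : 'I_d -> F) (A : {set 'I_d}) c :
  (\prod_(i in A) ('X - (f i)%:P)).[c] = \prod_(i in A) (c - f i).
  by rewrite horner_prod; apply: eq_bigr => i _; rewrite !hornerE.
rewrite !h_ratfunE invf_div.
rewrite resultant_mero_prod ?size_map -?cardE //; first last.
- move=> c; rewrite mem_cat big_map big_enum hc => cIJ.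
  apply/prodf_neq0 => k; rewrite inE => kI.
  rewrite subr_eq0; apply: contraNneq kI => ck; move: cIJ; rewrite ck.
  rewrite (mem_map a_inj) mem_enum => /orP[//|/mapP[j _ /ab//]].
- rewrite cat_uniq !map_inj_uniq ?enum_uniq // andbT /=.
  by apply/hasPn => _ /mapP[j _ ->]; apply/negP => /mapP[i _ /esym/ab].
rewrite !big_map !big_enum /=.
under eq_bigr do rewrite !hc.
under [X in _ / X = _]eq_bigr do rewrite !hc.
by rewrite !big_split /= !prodfV invf_div mulf_div.
Qed.

(** [sum_split_term] divided by its right-hand side, the b's being the [b j]
    with [j] in [J] and the c's the other ones. *)
Lemma sum_split_products d (a b : 'I_d -> F) (J : {set 'I_d}) :
  injective a -> injective b ->
  \sum_(I : {set 'I_d} | #|I| == #|J|)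
  (\prod_(i in I) \prod_(l in ~: J) (a i - b l)) *
  (\prod_(j in J) \prod_(k in ~: I) (b j - a k)) /
  ((\prod_(i in I) \prod_(k in ~: I) (a i - a k)) *
   (\prod_(j in J) \prod_(l in ~: J) (b j - b l))) = 1.
Proof.
move=> a_inj b_inj; set D := \prod_(j in J) \prod_(l in ~: J) (b j - b l).
have D0 : D != 0.
  apply/prodf_neq0 => j jJ; apply/prodf_neq0 => l; rewrite inE => lJ.
  by rewrite subr_eq0 (inj_eq b_inj); apply: contraNneq lJ => <-.
have := @sum_split_term F _ a a_inj [seq b j | j <- enum J]
  [seq b l | l <- enum (~: J)] [set: 'I_d]%SET.
rewrite !size_map -!cardE cardsT cardsC => /(_ erefl).
rewrite big_map big_enum /=.
under [RHS]eq_bigr do rewrite big_map big_enum.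
rewrite -/D => e; rewrite -[RHS](mulfV D0) -[X in _ = X / _]e mulr_suml.
apply: eq_big => [I|I _]; first by rewrite finset.subsetT.
rewrite /split_term finset.setTD invfM mulrA; congr (_ * _ / _ / _).
  by apply: eq_bigr => i _; rewrite big_map big_enum.
by rewrite exchange_big; apply: eq_bigr => k _; rewrite big_map big_enum.
Qed.

End Resultant.

Theorem proposition2 (R : realType) (d : nat) (a b : 'I_d -> R[i])
    (d_ge1 : (1 <= d)%N)
    (a_inj : injective a) (b_inj : injective b)
    (ab_neq : forall i j : 'I_d, a i <> b j)
    (m : nat) (m_le : (m <= d)%N)
    (J : {set 'I_d}) (cardJ : #|J| = m) :
  \sum_(I : {set 'I_d} | #|I| == m)
     resultant_mero (h_ratfun a b I J) (h_ratfun a b (~: I) (~: J))^-1 = 1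
  /\
  \sum_(I : {set 'I_d} | #|I| == m)
     resultant_mero (h_ratfun a b J I) (h_ratfun a b (~: J) (~: I))^-1 = 1.
Proof.
subst m; split.
  rewrite -[RHS](sum_split_products J a_inj b_inj).
  by apply: eq_bigr => I /eqP cardI; rewrite resultant_mero_h.
rewrite -[RHS](sum_split_products J b_inj a_inj).
apply: eq_bigr => I /eqP cardI; rewrite resultant_mero_h //.
by congr (_ / _); rewrite mulrC.
Qed.
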